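(* Let $q$ be a prime power, let $P$ be a set of points in $\mathbb{F}_q^3$ and let $\Pi$ be a set of planes in $\mathbb{F}_q^3$, each of the form $\{x\in\mathbb{F}_q^3 : a\cdot x=1\}$ with $a\in\mathbb{F}_q^3$. Let $k$ be a positive integer and $\alpha\in(0,1)$. If there is no line that contains $k$ points (i.e. at least $k$ points) of $P$ and is contained in two distinct planes of $\Pi$, and if $|P|\ge 2kq^{\alpha}$, then $$I(P,\Pi)\ll \frac{|P||\Pi|}{q^{\alpha}}+|P|q^{2\alpha}.$$
   Context: $\mathbb{F}_q$ is the finite field with $q$ elements, $q$ a prime power, and $a\cdot x=a_1x_1+a_2x_2+a_3x_3$ for $a,x\in\mathbb{F}_q^3$. $I(P,\Pi)$ is the number of pairs $(p,\pi)\in P\times\Pi$ with $p\in\pi$. The notation $f\ll g$ means $f=O(g)$, i.e. $f\le Cg$ with an absolute constant $C>0$ (independent of $q$, $\alpha$, $k$ and the sets). *)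

(* Defs.v *)
From mathcomp Require Import all_boot all_order all_algebra.

Set Implicit Arguments.
Unset Strict Implicit.
Unset Printing Implicit Defensive.

Import GRing.Theory.
Local Open Scope ring_scope.

Section FiniteAffineSpace.
Variable F : finFieldType.

Definition dot3 (a x : 'rV[F]_3) : F := \sum_(i < 3) a 0 i * x 0 i.

Definition hyperplane (a : 'rV[F]_3) (b : F) : {set 'rV[F]_3} :=
  [set x | dot3 a x == b].

Definition is_plane (pi : {set 'rV[F]_3}) : Prop :=
  exists a b, a != 0 /\ pi = hyperplane a b.

Definition is_line (L : {set 'rV[F]_3}) : Prop :=
  exists p d : 'rV[F]_3, d != 0 /\ L = [set p + t *: d | t : F].

Definition incidences (P : {set 'rV[F]_3}) (Pi : {set {set 'rV[F]_3}}) : nat :=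
  #|[set u in setX P Pi | u.1 \in u.2]|.

End FiniteAffineSpace.

(* Main.v *)
(** Planes of Pi with fewer than r = |P| / q^alpha points of P contribute at
    most |P||Pi| / q^alpha incidences, so it suffices to show that each point p
    lies on at most 4 q^(2 alpha) rich planes. For a rich plane pi through p,
    count the pairs (x, y) of points of P in pi such that pi is the only plane
    of Pi through p, x and y. If x != p and some other plane of Pi passes
    through p, x and y, then y is on the line px, which lies in two planes of
    Pi and so has fewer than k <= r / 2 points of P. Hence pi has at least
    (r - 1) (r - k) >= r^2 / 4 such pairs; these sets of pairs are disjoint for
    different planes, and there are at most |P|^2 pairs in total. *)
Require Import Defs.
From mathcomp Require Import all_boot all_order all_algebra.
From mathcomp Require Import reals exp.
From mathcomp Require Import lra.
Set Implicit Arguments.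
Unset Strict Implicit.
Unset Printing Implicit Defensive.
Import Order.TTheory GRing.Theory Num.Theory.
Local Open Scope ring_scope.

(** * Double counting in finite sets *)

Lemma leq_mul_card_fibers (T U : finType) (A : {set T}) (B : {set T * U}) n :
  (forall x, x \in A -> (n <= #|[set y | (x, y) \in B]|)%N) ->
  (#|A| * n <= #|B|)%N.
Proof.
move=> fibB; have -> : #|B| = (\sum_x \sum_(y | (x, y) \in B) 1)%N.
  by rewrite pair_big_dep -sum1_card; apply: eq_bigl => -[].
rewrite [leqRHS](bigID (mem A)) /= -sum_nat_const.
apply: leq_trans (leq_addr _ _); apply: leq_sum => x Ax.
by rewrite sum1dep_card; apply: fibB.
Qed.

(** Disjointness recovers [i] from [x], so the pairs [(i, x)] with [x] in [B i] project injectively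
    into [D]. *)
Lemma sum_card_le_disjoint (I T : finType) (S : {set I}) (B : I -> {set T})
    (D : {set T}) n :
  (forall i, i \in S -> B i \subset D) ->
  (forall i j x, i \in S -> j \in S -> x \in B i -> x \in B j -> i = j) ->
  (forall i, i \in S -> (n <= #|B i|)%N) ->
  (#|S| * n <= #|D|)%N.
Proof.
move=> subD disjB lenB.
pose E := [set u : I * T | (u.1 \in S) && (u.2 \in B u.1)].
have leE : (#|S| * n <= #|E|)%N.
  apply: leq_mul_card_fibers => i Si; apply: leq_trans (lenB i Si) _.
  by apply/subset_leq_card/subsetP => x Bx; rewrite !inE Si.
apply: leq_trans leE _; rewrite -(@card_in_imset _ _ snd) => [|[i x] [j y]].
  apply/subset_leq_card/subsetP => _ /imsetP[[i x] /[!inE]/andP[Si Bx] ->].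
  exact: subsetP (subD i Si) _ Bx.
rewrite !inE /= => /andP[Si Bx] /andP[Sj By] exy; rewrite -{y}exy in By *.
by rewrite (disjB i j x).
Qed.

(** * Lines and planes in three-dimensional space *)

Section Geometry.
Variable F : finFieldType.
Implicit Types (a b p x y : 'rV[F]_3) (P pi : {set 'rV[F]_3}).

Lemma dot3E a x : dot3 a x = (x *m a^T) 0 0.
Proof. by rewrite mxE; apply: eq_bigr => i _; rewrite mxE mulrC. Qed.

Lemma dot3D a x y : dot3 a (x + y) = dot3 a x + dot3 a y.
Proof. by rewrite !dot3E mulmxDl mxE. Qed.

Lemma dot3B a x y : dot3 a (x - y) = dot3 a x - dot3 a y.
Proof. by rewrite !dot3E mulmxBl !mxE. Qed.

Lemma dot3Z a c x : dot3 a (c *: x) = c * dot3 a x.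
Proof. by rewrite !dot3E -scalemxAl mxE. Qed.

(** Rank-nullity: independent [a] and [b] give a matrix of rank 2, whose orthogonal space has
    dimension 3 - 2 = 1 and is therefore spanned by the nonzero vector [x]. *)
Lemma orthogonal_pair_collinear a b x y :
  a != 0 -> (forall c, b != c *: a) ->
  x != 0 -> dot3 a x = 0 -> dot3 b x = 0 -> dot3 a y = 0 -> dot3 b y = 0 ->
  exists t, y = t *: x.
Proof.
move=> a0 ba x0 ax bx ay by_.
have rk2 : \rank (col_mx a b) = 2%N.
  apply/eqP; rewrite eqn_leq rank_leq_row -addsmxE ltnNge /=.
  apply/negP => rk1.
  (* If the rank were at most 1, the nonzero row [a] would already span both rows, making [b] a
     multiple of [a]. *)
  have /eqmxP/eqmx_sym ab : (a == a + b)%MS.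
    by rewrite -(geq_leqif (mxrank_leqif_eq (addsmxSl a b))) rank_rV a0.
  have /sub_rVP[c bc] : (b <= a)%MS by rewrite -ab addsmxSr.
  by have := ba c; rewrite bc eqxx.
have inker z : dot3 a z = 0 -> dot3 b z = 0 -> (z <= kermx (col_mx a b)^T)%MS.
  move=> az bz; apply/sub_kermxP; rewrite tr_col_mx mul_mx_row.
  have z0 c : dot3 c z = 0 -> z *m c^T = 0.
    by move=> cz; apply/matrixP => i j; rewrite !ord1 -dot3E cz mxE.
  by rewrite !z0 // row_mx0.
have /eqmxP xker : (x == kermx (col_mx a b)^T)%MS.
  rewrite -(geq_leqif (mxrank_leqif_eq (inker x ax bx))).
  by rewrite mxrank_ker mxrank_tr rk2 rank_rV x0.
by apply/sub_rVP; rewrite xker; apply: inker.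
Qed.

Definition line_through p x : {set 'rV[F]_3} := [set p + t *: (x - p) | t : F].

Lemma is_line_through p x : x != p -> is_line (line_through p x).
Proof. by move=> xp; exists p, (x - p); rewrite subr_eq0. Qed.

Lemma line_through_sub a c p x :
  p \in hyperplane a c -> x \in hyperplane a c ->
  line_through p x \subset hyperplane a c.
Proof.
rewrite !inE => /eqP ap /eqP ax; apply/subsetP => _ /imsetP[t _ ->].
by rewrite inE dot3D dot3Z dot3B ap ax subrr mulr0 addr0.
Qed.

(** The common right-hand side 1 forces independent normals: if [b = c *: a], evaluation at the
    common point [p] gives [c = 1] and the planes coincide. Both [x - p] and [y - p] are orthogonal
    to the two normals, hence proportional. *)
Lemma mem_line_through a b p x y :
  hyperplane a 1 != hyperplane b 1 -> x != p ->
  p \in hyperplane a 1 :&: hyperplane b 1 ->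
  x \in hyperplane a 1 :&: hyperplane b 1 ->
  y \in hyperplane a 1 :&: hyperplane b 1 ->
  y \in line_through p x.
Proof.
rewrite !inE => nab xp /andP[/eqP ap /eqP bp] /andP[/eqP ax /eqP bx].
move=> /andP[/eqP ay /eqP by_].
have a0 : a != 0.
  by apply: contra_eqN ap => /eqP->; rewrite dot3E trmx0 mulmx0 mxE eq_sym oner_neq0.
have ba c : b != c *: a.
  apply: contraNneq nab => bc; move: (bp).
  have -> : dot3 b p = c * dot3 a p by rewrite !dot3E bc linearZ /= -scalemxAr mxE.
  by rewrite ap mulr1 => c1; rewrite bc c1 scale1r.
have [] := @orthogonal_pair_collinear a b (x - p) (y - p) a0 ba.
- by rewrite subr_eq0.
- by rewrite dot3B ax ap subrr.
- by rewrite dot3B bx bp subrr.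
- by rewrite dot3B ay ap subrr.
- by rewrite dot3B by_ bp subrr.
by move=> t yE; apply/imsetP; exists t; rewrite // -yE addrC subrK.
Qed.

(** * Rich planes through a fixed point *)

Section Pencil.
Variables (P : {set 'rV[F]_3}) (Pi : {set {set 'rV[F]_3}}) (k : nat).
Hypothesis planes : forall pi, pi \in Pi -> exists a, pi = hyperplane a 1.
Hypothesis few_collinear : forall L pi1 pi2, is_line L ->
  pi1 \in Pi -> pi2 \in Pi -> pi1 != pi2 -> L \subset pi1 -> L \subset pi2 ->
  (#|L :&: P| < k)%N.

Definition isolating_pairs p pi : {set 'rV[F]_3 * 'rV[F]_3} :=
  [set u in setX (P :&: pi) (P :&: pi) |
    [forall pi' in Pi, [&& p \in pi', u.1 \in pi' & u.2 \in pi'] ==> (pi' == pi)]].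

(** Each first component [x] other than [p] admits at least [#|P :&: pi| - k] second components
    [y]. *)
Lemma card_isolating_pairs p pi : pi \in Pi -> p \in pi ->
  (#|P :&: pi|.-1 * (#|P :&: pi| - k) <= #|isolating_pairs p pi|)%N.
Proof.
move=> Pi_pi p_pi.
apply: (@leq_trans (#|(P :&: pi) :\ p| * (#|P :&: pi| - k))).
  rewrite leq_mul2r; apply/orP; right.
  (* The point [p] may lie outside [P], so removing it costs at most one point. *)
  by rewrite (cardsD1 p (P :&: pi)); case: (p \in P :&: pi); rewrite ?leq_pred.
apply: (@leq_mul_card_fibers _ _ ((P :&: pi) :\ p)) => x; rewrite 3!inE => /andP[xp /andP[Px pi_x]].
(* If [pi] is the only plane of [Pi] through [p] and [x], every [y] is allowed. Otherwise a second
   plane contains the line through [p] and [x], so [few_collinear] applies and only the fewer than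
   [k] points of [P] on this line are discarded. *)
have [sep|] := boolP [forall (pi' | [&& pi' \in Pi, p \in pi' & x \in pi']), pi' == pi].
  apply: leq_trans (leq_subr _ _) _; apply/subset_leq_card/subsetP => y.
  rewrite !inE /= => /andP[-> ->]; rewrite Px pi_x /=.
  apply/forall_inP => pi' Pi'; apply/implyP => /and3P[p' x' _].
  by move/forall_inP: sep; apply; rewrite Pi' p' x'.
rewrite negb_forall_in => /exists_inP[pi1 /and3P[Pi1 p1 x1] ne1].
have [a pia] := planes Pi_pi; have [b pib] := planes Pi1.
have lt_k : (#|line_through p x :&: P| < k)%N.
  apply: (@few_collinear _ pi1 pi) => //; first exact: is_line_through.
    by rewrite pib; apply: line_through_sub; rewrite -pib.
  by rewrite pia; apply: line_through_sub; rewrite -pia.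
apply: (@leq_trans #|(P :&: pi) :\: (line_through p x :&: P)|).
  rewrite cardsD; apply: leq_sub2l; apply: leq_trans (ltnW lt_k).
  by apply/subset_leq_card/subsetIr.
apply/subset_leq_card/subsetP => y.
rewrite 4!inE => /andP[+ /andP[Py pi_y]]; rewrite Py andbT => yl.
rewrite !inE /= Px pi_x Py pi_y /=; apply/forall_inP => pi' Pi'.
apply/implyP => /and3P[p' x' y']; apply: contraNT yl => ne'.
have [c pic] := planes Pi'.
by apply: (@mem_line_through c a); rewrite -?pic -?pia // inE ?p' ?x' ?y'.
Qed.

Lemma rich_planes_through_point p (S : {set {set 'rV[F]_3}}) n :
  S \subset Pi -> (forall pi, pi \in S -> p \in pi /\ (n <= #|P :&: pi|)%N) ->
  (#|S| * (n.-1 * (n - k)) <= #|P| ^ 2)%N.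
Proof.
move=> sSPi richS; rewrite -mulnn -cardsX.
apply: (@sum_card_le_disjoint _ _ _ (isolating_pairs p)).
- move=> pi Spi; apply/subsetP => u; rewrite !inE.
  by case/andP => /andP[/andP[-> _] /andP[-> _]].
(* A pair isolating [pi'] lies in no other plane of [Pi] through [p]; this gives disjointness. *)
- move=> pi pi' u Spi Spi'; rewrite !inE.
  case/andP => /andP[/andP[_ u1] /andP[_ u2]] _ /andP[_ /forall_inP] uniq'.
  have /implyP := uniq' _ (subsetP sSPi _ Spi).
  by rewrite u1 u2 (richS _ Spi).1 => /(_ isT)/eqP.
move=> pi Spi; have [p_pi lePpi] := richS _ Spi.
apply: leq_trans (card_isolating_pairs (subsetP sSPi _ Spi) p_pi).
by apply: leq_mul; [rewrite -!subn1|]; apply: leq_sub2r.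
Qed.

End Pencil.

(** * Incidences summed over planes, for the poor ones, and over points, for the rich ones *)

Lemma incidences_sum_planes P (Pi : {set {set 'rV[F]_3}}) :
  incidences P Pi = (\sum_(pi in Pi) #|P :&: pi|)%N.
Proof.
transitivity (\sum_(pi in Pi) \sum_(p in P | p \in pi) 1)%N; last first.
  by apply: eq_bigr => pi _; rewrite -sum1_card; apply: eq_bigl => p; rewrite inE.
rewrite (exchange_big_dep (mem P)) /=; last by move=> ? ? _ /andP[].
rewrite pair_big_dep /= /incidences -sum1_card; apply: eq_bigl => -[p pi].
by rewrite !inE /=; case: (p \in P).
Qed.

Lemma incidences_sum_points P (Pi : {set {set 'rV[F]_3}}) :
  incidences P Pi = (\sum_(p in P) #|[set pi in Pi | p \in pi]|)%N.
Proof.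
rewrite incidences_sum_planes.
under eq_bigr do rewrite -sum1_card.
rewrite (exchange_big_dep (mem P)) /=; last by move=> ? ? _ /setIP[].
apply: eq_bigr => p Pp; rewrite -sum1_card; apply: eq_bigl => pi.
by rewrite !inE Pp.
Qed.

End Geometry.

Theorem theorem1p4 (R : realType) :
  exists C : R, 0 < C /\
    forall (F : finFieldType) (q : nat) (P : {set 'rV[F]_3})
           (Pi : {set {set 'rV[F]_3}}) (k : nat) (alpha : R),
      #|F| = q ->
      (forall pi, pi \in Pi ->
         is_plane pi /\ exists a : 'rV[F]_3, pi = hyperplane a 1) ->
      (0 < k)%N ->
      0 < alpha < 1 ->
      ~ (exists L : {set 'rV[F]_3},
           [/\ is_line L, (k <= #|L :&: P|)%N &
               exists pi1 pi2, [/\ pi1 \in Pi, pi2 \in Pi, pi1 != pi2,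
                                   L \subset pi1 & L \subset pi2]]) ->
      2 * k%:R * q%:R `^ alpha <= #|P|%:R ->
      (incidences P Pi)%:R <=
        C * (#|P|%:R * #|Pi|%:R / q%:R `^ alpha
             + #|P|%:R * q%:R `^ (2 * alpha)).
Proof.
(* The 4 is the inverse of the factor 1/4 in [pairs_ge]; poor planes would need only 1. *)
exists 4; split=> // F q P Pi k alpha cardF planes k_gt0 _ noline.
have q_gt0 : 0 < q%:R :> R by rewrite ltr0n -cardF; apply/card_gt0P; exists 0.
rewrite [2 * alpha]mulrC powRrM powR_mulrn ?powR_ge0 //.
have := powR_gt0 alpha q_gt0; move: (q%:R `^ alpha) => s s_gt0 leP.
pose r : R := #|P|%:R / s.
have Pr : #|P|%:R = r * s by rewrite /r divfK // gt_eqF.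
have k1 : 1 <= k%:R :> R by rewrite ler1n.
have r2k : 2 * k%:R <= r by rewrite /r ler_pdivlMr // mulrC.
pose rich := [set pi in Pi | r <= #|P :&: pi|%:R].
pose poor := [set pi in Pi | #|P :&: pi|%:R < r].
have few L pi1 pi2 : is_line L -> pi1 \in Pi -> pi2 \in Pi -> pi1 != pi2 ->
    L \subset pi1 -> L \subset pi2 -> (#|L :&: P| < k)%N.
  move=> lL Pi1 Pi2 ne s1 s2; rewrite ltnNge; apply/negP => kL.
  by apply: noline; exists L; split=> //; exists pi1, pi2.
have -> : incidences P Pi = (incidences P poor + incidences P rich)%N.
  rewrite !incidences_sum_planes (bigID (fun pi => #|P :&: pi|%:R < r)) /=.
  by congr (_ + _)%N; apply: eq_bigl => pi; rewrite inE -?leNgt.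
have Ipoor : (incidences P poor)%:R <= #|Pi|%:R * r.
  rewrite incidences_sum_planes natr_sum.
  apply: (@le_trans _ _ (\sum_(pi in poor) r)).
    by apply: ler_sum => pi /[!inE]/andP[_ /ltW].
  rewrite sumr_const -[_ *+ _]mulr_natl ler_wpM2r //; first by lra.
  rewrite ler_nat; apply/subset_leq_card/subsetP => pi.
  by rewrite inE => /andP[].
have Irich : (incidences P rich)%:R <= #|P|%:R * (4 * s ^+ 2).
  rewrite incidences_sum_points natr_sum mulr_natl -sumr_const.
  apply: ler_sum => p _; set S := [set _ in _ | _].
  have [->|[pi0 Spi0]] := set_0Vmem S.
    by rewrite cards0 mulr_ge0 // exprn_ge0 // ltW.
  (* Taking the least number of points on a rich plane through [p] gives an integer bound without
     rounding [r]; the minimum exists because [S] is nonempty. *)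
  have [n rn minn] : exists2 n, r <= n%:R & forall pi, pi \in S -> (n <= #|P :&: pi|)%N.
    case: (arg_minnP (fun pi => #|P :&: pi|%N) Spi0) => pi Spi minpi.
    by exists #|P :&: pi| => //; have : pi \in S := Spi; rewrite !inE => /andP[/andP[]].
  have kn : (k <= n)%N by rewrite -(ler_nat R); lra.
  have n_gt0 : (0 < n)%N by apply: leq_trans kn.
  have : (#|S| * (n.-1 * (n - k)) <= #|P| ^ 2)%N.
    apply: (@rich_planes_through_point F P Pi k _ few p).
    - by move=> pi /planes[].
    - by apply/subsetP => pi; rewrite !inE => /andP[/andP[]].
    - by move=> pi Spi; split; [move: Spi; rewrite inE => /andP[] | apply: minn].
  rewrite -(ler_nat R) natrX !natrM -subn1 !natrB // Pr => leS.
  (* Since [n >= r >= 2k >= 2], each factor is at least [r / 2]. *)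
  have pairs_ge : r ^+ 2 / 4 <= (n%:R - 1) * (n%:R - k%:R).
    apply: (@le_trans _ _ (r / 2 * (r / 2))); first by lra.
    by apply: ler_pM; lra.
  have r_gt0 : 0 < r by lra.
  have : #|S|%:R * (r ^+ 2 / 4) <= (r * s) ^+ 2.
    by apply: le_trans leS; apply: ler_wpM2l.
  (* Cancelling [r ^+ 2] leaves [4 * s ^+ 2] as the bound on the number of rich planes through
     [p]. *)
  by rewrite (exprMn 2 r s) -(ler_pM2l (exprn_gt0 2 r_gt0)) => {}leS; lra.
have rPi_ge0 : 0 <= #|Pi|%:R * r by rewrite mulr_ge0 //; lra.
rewrite natrD (le_trans (lerD Ipoor Irich)) // mulrAC -/r; lra.
Qed.
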